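(* Let $s=(u_1,u_2,u_3)$ be a state, with real embedding vector $\xi$ and complex embedding vector $\nu$, and let $n_1=\xi\times\nu$. Then $$\langle n_1,n_1\rangle=\mathrm{disc}(u_1,u_2,u_3)\cdot\overline{\sigma_c}(Q^\vee),$$ and consequently the score satisfies $$|\mathrm{score}(s)|=\frac{\sigma_r(Q)}{|\mathrm{disc}(u_1,u_2,u_3)|\cdot|\sigma_c(Q^\vee)|^2}.$$
   Context: $K$ is a cubic number field of signature $(1,1)$, with real embedding $\sigma_r$ and complex embedding $\sigma_c$ (conjugate embedding $\overline{\sigma_c}$); $L\subset\mathcal O_K$ is an order. A state is an ordered triple $s=(u_1,u_2,u_3)$ of elements of $L$ forming a $\mathbb Q$-basis of $K$; it is admissible if $x_i:=\sigma_r(u_i)>0$ for all $i$, and it is sorted so that $x_1\ge x_2\ge x_3>0$. Put $\xi=(x_1,x_2,x_3)\in\mathbb R^3$ and $\nu=(\sigma_c(u_1),\sigma_c(u_2),\sigma_c(u_3))\in\mathbb C^3$. Cross products $\times$ and dot products $\langle\cdot,\cdot\rangle$ on $\mathbb C^3$ are bilinear (non-Hermitian). The trace-dual basis $(u_1^\vee,u_2^\vee,u_3^\vee)$ is defined by $\mathrm{Tr}_{K/\mathbb Q}(u_iu_j^\vee)=\delta_{ij}$ (Kronecker delta). Put $Q=u_1^2+u_2^2+u_3^2\in K$ and $Q^\vee=(u_1^\vee)^2+(u_2^\vee)^2+(u_3^\vee)^2\in K$. $\mathrm{disc}(u_1,u_2,u_3)$ is the discriminant of the triple, i.e. the square of the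 determinant of the matrix $(\sigma(u_i))_{i,\sigma}$ with $\sigma\in\{\sigma_r,\sigma_c,\overline{\sigma_c}\}$. The score of $s$ is a negative real number with absolute value $$|\mathrm{score}(s)|=\frac{|\det(\xi,\nu,\bar\nu)|^2\,|\xi|^2}{|\langle n_1,n_1\rangle|^2},\qquad n_1=\xi\times\nu .$$ *)

(* Defs.v *)
From HB Require Import structures.
From mathcomp Require Import all_boot all_order all_algebra all_field.
From mathcomp Require Import boolp classical_sets cardinality reals.
From mathcomp Require Import complex.

Set Implicit Arguments.
Unset Strict Implicit.
Unset Printing Implicit Defensive.

Import Order.TTheory GRing.Theory Num.Theory.

Import Normc.

Local Open Scope classical_set_scope.
Local Open Scope card_scope.
Local Open Scope ring_scope.
Local Open Scope complex_scope.

Section Vectors.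
Variable F : fieldType.

(* Bilinear also over the complex numbers: no conjugation. *)
Definition dotmul (v w : 'rV[F]_3) : F := \sum_(i < 3) v 0 i * w 0 i.

Definition crossmul (v w : 'rV[F]_3) : 'rV[F]_3 :=
  \row_(i < 3) (v 0 (ordS i) * w 0 (ordS (ordS i))
                - v 0 (ordS (ordS i)) * w 0 (ordS i)).

Definition det3 (a b c : 'rV[F]_3) : F :=
  \det (\matrix_(i < 3, j < 3) tnth [tuple a; b; c] j 0 i).

End Vectors.

Section NumberField.
Variable K : fieldExtType rat.

Definition trace (x : K) : rat :=
  \tr (passmx.mxof (vbasis {:K}) (vbasis {:K}) (amull x)).

Definition trace_dual (u ud : 3.-tuple K) : Prop :=
  forall i j : 'I_3, trace (tnth u i * tnth ud j) = (i == j)%:R.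

Definition ring_of_integers : set K :=
  [set x | integralOver (intr : int -> K) x].

(* [inIntSpan b x] says that x is an integral linear combination of b, so L is
   a subring of O_K possessing a Z-basis that is a Q-basis of K. *)
Definition is_order (L : {pred K}) : Prop :=
  [/\ subring_closed L,
      [set` L] `<=` ring_of_integers
    & exists b : (\dim {:K}).-tuple K,
        basis_of {:K} b /\ forall x, x \in L <-> inIntSpan b x].

(* Neither positivity of the real embeddings (admissibility) nor an ordering
   of the u_i is required. *)
Definition is_state (L : {pred K}) (u : 3.-tuple K) : Prop :=
  {subset u <= L} /\ basis_of {:K} u.

Definition sum_sq (u : 3.-tuple K) : K := \sum_(i < 3) tnth u i ^+ 2.

Variable R : realType.

Definition is_real_embedding (s : {rmorphism K -> R[i]}) : Prop :=
  forall x, s x \is Num.real.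

Definition has_signature (r1 r2 : nat) : Prop :=
  [set s : {rmorphism K -> R[i]} | is_real_embedding s] #= `I_r1 /\
  [set s : {rmorphism K -> R[i]} | ~ is_real_embedding s] #= `I_(2 * r2).

Variables (sr : {rmorphism K -> R}) (sc : {rmorphism K -> R[i]}).

Definition embeddings : 3.-tuple (K -> R[i]) :=
  [tuple (fun x => (sr x)%:C); (fun x => sc x); (fun x => (sc x)^*%R)].

Definition disc (u : 3.-tuple K) : R[i] :=
  (\det (\matrix_(i < 3, j < 3) tnth embeddings j (tnth u i))) ^+ 2.

Definition xi (u : 3.-tuple K) : 'rV[R]_3 := \row_i sr (tnth u i).

Definition nu (u : 3.-tuple K) : 'rV[R[i]]_3 := \row_i sc (tnth u i).

Definition n1 (u : 3.-tuple K) : 'rV[R[i]]_3 :=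
  crossmul (map_mx (real_complex R) (xi u)) (nu u).

(* [normc : R[i] -> R] is the real-valued modulus. *)
Definition score (u : 3.-tuple K) : R :=
  - (normc (det3 (map_mx (real_complex R) (xi u)) (nu u)
                 (map_mx Num.conj (nu u))) ^+ 2
     * dotmul (xi u) (xi u)
     / normc (dotmul (n1 u) (n1 u)) ^+ 2).

End NumberField.

(* Main.v *)
Require Import Defs.
From mathcomp Require Import all_boot all_order all_algebra all_field.
From mathcomp Require Import reals complex.
From mathcomp Require Import ring.

Import GRing.Theory Num.Theory Normc.
Local Open Scope ring_scope.
Local Open Scope complex_scope.

(** Write [sigma_k] for the real, the complex and the conjugate embedding.  The
    trace of [K] is their sum ([trace_sum_embeddings]), so the relations
    [Tr (u_i ud_j) = delta_ij] say that the matrices [U = (sigma_k (u_i))] and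
    [D = (sigma_k (ud_j))] satisfy [U D^T = 1].  Then also [D^T U = 1]
    ([embeddings_dual]): the vector [w] of the conjugate embeddings of the
    [ud_i] is orthogonal to [xi] and [nu], and pairs to [1] with the conjugate
    of [nu].  Cramer's rule turns this into [xi x nu = det U *: w]
    ([crossmul_dual_vector]).  Squaring for the bilinear product gives
    [<n1, n1> = (det U)^2 <w, w>], which is the first formula because
    [(det U)^2] is the discriminant and [<w, w>] is the conjugate embedding of
    [sum_sq ud].  The score formula follows by taking absolute values: the
    factor [|det U|^2] of the numerator cancels one of the two factors [|disc|]
    of the denominator.

    The trace is defined by the matrix of a multiplication operator.  The
    embeddings diagonalize all these operators simultaneously, provided that
    they are linearly independent, and a Vandermonde determinant shows this as
    soon as some [y] in [K] has distinct images ([embedding_matrix_unit]). *)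

(** * The trace as a sum of embeddings *)

(** Evaluating the embeddings at the powers of [y] factors a Vandermonde matrix
    through the matrix of the embeddings on the basis. *)
Lemma embedding_matrix_unit (K : fieldExtType rat) (C : numFieldType)
    (f : 'I_(\dim {:K}) -> {rmorphism K -> C}) (y : K) :
    injective (fun k => f k y) ->
  \matrix_(i, k) f k (vbasis {:K})`_i \in unitmx.
Proof.
move=> f_inj; set N := \matrix_(i, k) _.
pose B : 'M[rat]_(\dim {:K}) := \matrix_(i, j) coord (vbasis {:K}) j (y ^+ i).
have VE : Vandermonde (\dim {:K}) (\row_k f k y) = map_mx ratr B *m N.
  apply/matrixP=> i k; rewrite !mxE -rmorphXn /=.
  rewrite {1}(coord_vbasis (memvf (y ^+ i))) rmorph_sum.
  by apply: eq_bigr => j _; rewrite !mxE rmorphZ_num.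
suff: Vandermonde (\dim {:K}) (\row_k f k y) \in unitmx.
  by rewrite VE unitmx_mul => /andP[].
rewrite unitmxE det_Vandermonde unitfE.
apply/prodf_neq0 => i _; apply/prodf_neq0 => j lt_ij.
by rewrite !mxE subr_eq0 (inj_eq f_inj) -val_eqE /= gtn_eqF.
Qed.

(** Each embedding, read on the basis, is an eigenvector of every
    multiplication operator. *)
Lemma trace_sum_embeddings (K : fieldExtType rat) (C : numFieldType) (n : nat)
    (dimK : \dim {:K} = n) (f : 'I_n -> {rmorphism K -> C}) (y : K) :
    injective (fun k => f k y) ->
  forall x : K, ratr (trace x) = \sum_k f k x.
Proof.
subst n => f_inj x; have := embedding_matrix_unit _ _ _ _ f_inj.
set N := \matrix_(i, k) _ => N_unit.
set A := passmx.mxof (vbasis {:K}) (vbasis {:K}) (amull x).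
have AN : map_mx ratr A *m N = N *m diag_mx (\row_k f k x).
  apply/matrixP=> i k; rewrite mul_mx_diag !mxE -rmorphM /=.
  rewrite [_ * x]mulrC [x * _](coord_vbasis (memvf _)) rmorph_sum.
  apply: eq_bigr => j _.
  by rewrite !mxE /= passmx.vecof_delta lfunE rmorphZ_num.
rewrite /trace -/A -trace_map_mx.
have -> : map_mx ratr A = N *m diag_mx (\row_k f k x) *m invmx N :> 'M[C]__.
  by rewrite -AN mulmxK.
rewrite mxtrace_mulC mulmxA mulVmx // mul1mx mxtrace_diag.
by apply: eq_bigr => k _; rewrite mxE.
Qed.

(** * Cramer's rule in dimension three *)

(** Naming the coordinates by natural numbers makes the various expressions
    for one index of ['I_3] convertible. *)
Lemma coord_nat (F : fieldType) (n : nat) :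
  exists g : 'rV[F]_n.+1 -> nat -> F, forall (v : 'rV[F]_n.+1) i,
    v 0 i = g v (val i).
Proof. by exists (fun v k => v 0 (inord k)) => v i; rewrite inord_val. Qed.

Lemma det3E (F : fieldType) (a b c : 'rV[F]_3) :
  det3 a b c = dotmul (crossmul a b) c.
Proof.
have [g gE] := coord_nat F 2.
rewrite /det3 (expand_det_col _ ord_max) /dotmul !big_ord_recl !big_ord0.
rewrite /cofactor !(expand_det_row _ ord0) !big_ord_recl !big_ord0.
rewrite /cofactor !det_mx11 !mxE /= !(tnth_nth 0) /=.
by rewrite !gE /= /bump /=; ring.
Qed.

(** Cramer's rule in the basis dual to [a, b, c]. *)
Lemma crossmul_dual_vector (F : fieldType) (a b c w : 'rV[F]_3) :
    dotmul a w = 0 -> dotmul b w = 0 -> dotmul c w = 1 ->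
  crossmul a b = det3 a b c *: w.
Proof.
move=> aw bw cw.
have cramer : det3 a b c *: w = dotmul a w *: crossmul b c
    + dotmul b w *: crossmul c a + dotmul c w *: crossmul a b.
  have [g gE] := coord_nat F 2.
  rewrite det3E /dotmul !big_ord_recl !big_ord0.
  apply/rowP=> i; rewrite !mxE !gE.
  by case: i => [[|[|[|//]]] ?] /=; rewrite /bump /=; ring.
by rewrite cramer aw bw cw !scale0r !add0r scale1r.
Qed.

(** * Embeddings and the dual basis *)

Lemma embeddings_rmorphism (R : realType) (K : fieldExtType rat)
    (sr : {rmorphism K -> R}) (sc : {rmorphism K -> R[i]}) :
  exists f : 'I_3 -> {rmorphism K -> R[i]},
    forall k x, tnth (embeddings sr sc) k x = f k x.
Proof.
exists (tnth [tuple GRing.RMorphism.clone _ _ (real_complex R \o sr) _; sc;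
                    GRing.RMorphism.clone _ _ (Num.conj \o sc) _]).
by move=> k x; case: k => [[|[|[|//]]] ?].
Qed.

(** If [sc y] is not real, conjugation moves it, whereas it fixes [sr y]; hence
    the three images of [y] are distinct. *)
Lemma embeddings_separated (R : realType) (K : fieldExtType rat)
    (sr : {rmorphism K -> R}) (sc : {rmorphism K -> R[i]}) :
    ~ is_real_embedding sc ->
  exists y : K, injective (fun k => tnth (embeddings sr sc) k y).
Proof.
move=> /boolp.existsNP[y y_nonreal]; exists y.
have conj_neq : (sc y)^*%R <> sc y by move=> /CrealP.
have real_neq : (sr y)%:C <> sc y.
  by move=> E; apply: y_nonreal; rewrite -E complex_real.
have real_neq_conj : (sr y)%:C <> (sc y)^*%R.
  move=> E; apply: real_neq.
  by rewrite -[RHS]conjCK -E conj_Creal // complex_real.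
by case=> [[|[|[|//]]] i] [[|[|[|//]]] j] /= E;
  first [exact: val_inj | case: conj_neq; first [exact: E | exact: esym E]
        | case: real_neq; first [exact: E | exact: esym E]
        | case: real_neq_conj; first [exact: E | exact: esym E]].
Qed.

(** Duality for the trace form is the relation [U D^T = 1], which sums over the
    embeddings; exchanging the factors gives the orthogonality of the embedding
    vectors themselves, which sums over the basis. *)
Lemma embeddings_dual (R : realType) (K : fieldExtType rat)
    (K_cubic : \dim {:K} = 3%N)
    (sr : {rmorphism K -> R}) (sc : {rmorphism K -> R[i]})
    (sc_nonreal : ~ is_real_embedding sc)
    (u ud : 3.-tuple K) (ud_dual : trace_dual u ud) (k l : 'I_3) :
  \sum_i tnth (embeddings sr sc) k (tnth u i)
         * tnth (embeddings sr sc) l (tnth ud i) = (k == l)%:R.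
Proof.
have [f fE] := embeddings_rmorphism _ _ sr sc.
have [y y_inj] := embeddings_separated _ _ sr _ sc_nonreal.
have fy_inj : injective (fun k => f k y) by move=> k1 k2; rewrite -!fE => /y_inj.
pose U := \matrix_(i, k) f k (tnth u i).
pose D := \matrix_(j, k) f k (tnth ud j).
have UD : U *m D^T = 1%:M.
  apply/matrixP=> i j; rewrite !mxE -(ratr_nat R[i]) -ud_dual.
  rewrite (trace_sum_embeddings _ _ _ K_cubic _ _ fy_inj).
  by apply: eq_bigr => m _; rewrite !mxE rmorphM.
have /matrixP/(_ l k) := mulmx1C UD.
rewrite !mxE eq_sym => <-.
by apply: eq_bigr => i _; rewrite !mxE !fE mulrC.
Qed.

(** * The score *)

Lemma normc_conj (R : rcfType) (z : R[i]) : normc z^*%R = normc z.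
Proof. by apply: complexI; exact: norm_conjC. Qed.

Theorem theorem2p1 (R : realType) (K : fieldExtType rat)
    (K_cubic : \dim {:K} = 3%N) (K_sign : has_signature K R 1 1)
    (sr : {rmorphism K -> R}) (sc : {rmorphism K -> R[i]})
    (sc_nonreal : ~ is_real_embedding sc)
    (L : {pred K}) (L_order : is_order L)
    (u : 3.-tuple K) (u_state : is_state L u)
    (ud : 3.-tuple K) (ud_dual : trace_dual u ud) :
  dotmul (n1 sr sc u) (n1 sr sc u) = disc sr sc u * (sc (sum_sq ud))^*%R /\
  `|score sr sc u|
    = sr (sum_sq u) / (normc (disc sr sc u) * normc (sc (sum_sq ud)) ^+ 2).
Proof.
set a := map_mx (real_complex R) (xi sr u); set b := nu sc u.
set c := map_mx Num.conj b.
pose w : 'rV[R[i]]_3 := \row_i (sc (tnth ud i))^*%R.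
pose d := det3 a b c.
have discE : disc sr sc u = d ^+ 2.
  congr (\det _ ^+ 2); apply/matrixP=> i [[|[|[|//]]] ?];
    by rewrite !mxE.
(* [ord_max] is the index of the conjugate embedding. *)
have dual k :=
  embeddings_dual _ _ K_cubic sr sc sc_nonreal u ud ud_dual k ord_max.
have aw : dotmul a w = 0.
  by rewrite -[RHS](dual 0); apply: eq_bigr => i _; rewrite !mxE.
have bw : dotmul b w = 0.
  by rewrite -[RHS](dual 1); apply: eq_bigr => i _; rewrite !mxE.
have cw : dotmul c w = 1.
  by rewrite -[RHS](dual ord_max); apply: eq_bigr => i _; rewrite !mxE.
have n1E : dotmul (n1 sr sc u) (n1 sr sc u)
           = disc sr sc u * (sc (sum_sq ud))^*%R.
  rewrite /n1 -/a -/b (crossmul_dual_vector _ _ _ _ _ aw bw cw) -/d discE.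
  rewrite /sum_sq !rmorph_sum mulr_sumr; apply: eq_bigr => i _.
  by rewrite !mxE !rmorphXn /=; ring.
split=> //.
have xi_sq : dotmul (xi sr u) (xi sr u) = sr (sum_sq u).
  by rewrite /sum_sq rmorph_sum; apply: eq_bigr => i _; rewrite !mxE rmorphXn.
have sq_ge0 : 0 <= sr (sum_sq u).
  by rewrite rmorph_sum sumr_ge0 // => i _; rewrite rmorphXn sqr_ge0.
have normc_ge0 (z : R[i]) : 0 <= normc z by case: z => x y; exact: sqrtr_ge0.
rewrite /score -/a -/b -/c -/d xi_sq n1E normcM normc_conj discE.
have -> : normc (d ^+ 2) = normc d ^+ 2 by rewrite normcM.
move: (normc_ge0 d) (normc_ge0 (sc (sum_sq ud))) sq_ge0.
move: (normc d) (normc (sc (sum_sq ud))) (sr _) => e q x e_ge0 q_ge0 x_ge0.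
rewrite normrN ger0_norm; last by rewrite !(divr_ge0, mulr_ge0, exprn_ge0).
(* If a factor of the denominators vanishes, both sides are [0]. *)
have [-> | e_neq0] := eqVneq e 0; first by rewrite !(expr2, mul0r, mulr0, invr0).
have [-> | q_neq0] := eqVneq q 0; first by rewrite !(expr2, mul0r, mulr0, invr0).
by field; rewrite e_neq0 q_neq0.
Qed.
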